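(* Let $f: Y \twoheadrightarrow X$ be a coprime extension of indecomposable cycle sets. Then there exist an $X$-graded $\mathcal{G}(X)$-module $A$ and a map $\Phi: X \times X \to A$ with $\Phi(x,y)\in A_y$ and $\Phi(\lambda_g(x),\lambda_g(y)) = g\cdot \Phi(x,y)$ for all $x,y \in X$, $g \in \mathcal{G}(X)$, such that $f$ is equivalent to the twisted extension $\mathrm{pr}: X \otimes_{\Phi} A \to X$.
   Context: A cycle set is a finite set $X$ with a binary operation $\ast$ such that $(x\ast y)\ast(x\ast z)=(y\ast x)\ast(y\ast z)$ for all $x,y,z\in X$, each map $\sigma_x: X\to X$, $y\mapsto x\ast y$, is bijective, and $x\mapsto x\ast x$ is bijective (all cycle sets are assumed finite and nondegenerate). Homomorphisms are maps preserving $\ast$. The permutation group is $\mathcal{G}(X)=\langle \sigma_x : x\in X\rangle\leq \mathrm{Sym}(X)$; put $\lambda_x=\sigma_x^{-1}\in\mathcal{G}(X)$, and for $g\in\mathcal{G}(X)$ write $\lambda_g(x)$ for the image of $x\in X$ under $g$. $X$ is indecomposable if it has no partition into two nonempty sub-cycle sets; equivalently $\mathcal{G}(X)$ acts transitively on $X$. Extensions: for cycle sets $X,Y$ with $X$ indecomposable, a surjective homomorphism $f:Y\twoheadrightarrow X$ is an extension if $f(y)=f(y')$ implies $\sigma_y=\sigma_{y'}$ for all $y,y'\in Y$. It is an extension of indecomposable cycle sets if $Y$ is also indecomposable (then $|X|$ divides $|Y|$), and such an extension is coprime if $\gcd(|\mathcal{G}(X)|,|Y|/|X|)=1$. Two extensions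 $f_i:Y_i\twoheadrightarrow X$ ($i=1,2$) are equivalent if there is an isomorphism $\iota:Y_1\to Y_2$ with $f_1=f_2\circ\iota$. Graded modules: if a group $G$ acts on a set $X$, an $X$-graded $G$-module is an abelian group $A=\bigoplus_{x\in X}A_x$ with a $G$-action by automorphisms such that $g\cdot A_x\subseteq A_{g\cdot x}$. Its scattering is $A^{\mathrm{sc}}=\bigsqcup_{x\in X}\{x\}\times A_x$ with $G$-action $g\cdot(x,a)=(g\cdot x,g\cdot a)$. Twisted extensions: for a cycle set $X$, an $X$-graded $\mathcal{G}(X)$-module $A$, and $\Phi:X\times X\to A$ with $\Phi(x,y)\in A_y$ and $\Phi(\lambda_g(x),\lambda_g(y))=g\cdot\Phi(x,y)$, the twisted extension $X\otimes_\Phi A$ is the set $A^{\mathrm{sc}}$ with operation $(x,a)\ast(y,b)=(x\ast y,\ \lambda_x^{-1}\cdot(b+\Phi(x,y)))$, together with the projection $\mathrm{pr}:X\otimes_\Phi A\twoheadrightarrow X$, $(x,a)\mapsto x$. *)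

(* Defs.v *)
From HB Require Import structures.
From mathcomp Require Import all_boot all_algebra all_fingroup.

Set Implicit Arguments.
Unset Strict Implicit.
Unset Printing Implicit Defensive.

Import GRing.Theory.
Local Open Scope ring_scope.

Record cycleSet := CycleSet {
  cs_car :> finType;
  cs_op : cs_car -> cs_car -> cs_car;
  cs_eq : forall x y z,
    cs_op (cs_op x y) (cs_op x z) = cs_op (cs_op y x) (cs_op y z);
  cs_bij : forall x, bijective (cs_op x);
  cs_diag_bij : bijective (fun x => cs_op x x)
}.

Declare Scope cycle_set_scope.
Local Open Scope cycle_set_scope.
Notation "x ∗ y" := (cs_op x y) (at level 40, left associativity)
  : cycle_set_scope.

Definition cs_hom (X Y : cycleSet) (f : X -> Y) : Prop :=
  {morph f : x y / x ∗ y}.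

Definition cs_iso (X Y : cycleSet) (f : X -> Y) : Prop :=
  cs_hom f /\ bijective f.

Section PermutationGroup.
Variable X : cycleSet.

Definition sigma (x : X) : {perm X} := perm (bij_inj (cs_bij x)).

Definition lambda (x : X) : {perm X} := (sigma x)^-1%g.

Definition perm_group : {group {perm X}} := <<[set sigma x | x : X]>>%G.

Lemma sigmaE x y : sigma x y = x ∗ y.
Proof. by rewrite permE. Qed.

Lemma mem_sigma x : sigma x \in perm_group.
Proof. by apply/mem_gen/imset_f. Qed.

(* Bijectivity of the restricted maps is automatic, as [X] is finite. *)
Definition sub_cycle_set (S : {set X}) : Prop :=
  {in S &, forall x y, x ∗ y \in S}.

Definition indecomposable : Prop :=
  ~ exists S : {set X},
      [/\ S != set0, ~: S != set0, sub_cycle_set S & sub_cycle_set (~: S)].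

End PermutationGroup.

Definition extension (X Y : cycleSet) (f : Y -> X) : Prop :=
  [/\ cs_hom f,
      forall x, exists y, f y = x
    & forall y y', f y = f y' -> sigma y = sigma y'].

Definition coprime_extension (X Y : cycleSet) (f : Y -> X) : Prop :=
  [/\ indecomposable X, indecomposable Y, extension f
    & coprime #|perm_group X| (#|Y| %/ #|X|)].

Definition ext_equiv (X Y1 Y2 : cycleSet) (f1 : Y1 -> X) (f2 : Y2 -> X) :
  Prop := exists2 iota : Y1 -> Y2, cs_iso iota & f1 =1 f2 \o iota.

(* [gm_act a g] stands for g . a. A product [g * h] of permutations means     *)
(* "first g, then h", so that the right actions of MathComp are exactly the   *)
(* left actions of the group of permutations under composition of functions. *)
(* The module is finite because its scattering carries a finite cycle set.    *)
Record gradedModule (X : cycleSet) := GradedModule {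
  gm_car :> finZmodType;
  gm_comp : X -> {set gm_car};
  gm_act : action (perm_group X) gm_car;
  gm_comp_closed : forall x, GRing.zmod_closed (gm_comp x);
  gm_direct_sum : forall a : gm_car,
    exists! h : {ffun X -> gm_car},
      (forall x, h x \in gm_comp x) /\ a = \sum_x h x;
  gm_actD : forall g, g \in perm_group X ->
    {morph gm_act^~ g : a b / a + b};
  gm_act_comp : forall g x a, g \in perm_group X ->
    a \in gm_comp x -> gm_act a g \in gm_comp (g x)
}.

Section TwistedExtension.
Variables (X : cycleSet) (A : gradedModule X) (Phi : X -> X -> A).

Definition twisting : Prop :=
  (forall x y, Phi x y \in gm_comp A y) /\
  (forall g x y, g \in perm_group X ->
     Phi (g x) (g y) = gm_act A (Phi x y) g).

Definition scattering : finType := {u : X * A | u.2 \in gm_comp A u.1}.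

Hypothesis hPhi : twisting.

Definition twisted_val (u v : X * A) : X * A :=
  (u.1 ∗ v.1, gm_act A (v.2 + Phi u.1 v.1) (lambda u.1)^-1%g).

Lemma gm_compD x a b :
  a \in gm_comp A x -> b \in gm_comp A x -> a + b \in gm_comp A x.
Proof.
have [h0 hB] := gm_comp_closed A x.
move=> ha hb; rewrite -[b]opprK hB // -sub0r; exact: hB.
Qed.

Lemma twisted_subproof (u v : scattering) :
  (twisted_val (val u) (val v)).2
    \in gm_comp A (twisted_val (val u) (val v)).1.
Proof.
rewrite /= /lambda invgK -sigmaE; apply: gm_act_comp; first exact: mem_sigma.
by apply: gm_compD; [exact: (valP v) | exact: hPhi.1].
Qed.

Definition twisted_op (u v : scattering) : scattering :=
  Sub (twisted_val (val u) (val v)) (twisted_subproof u v).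

Lemma twisted_eq u v w :
  twisted_op (twisted_op u v) (twisted_op u w)
  = twisted_op (twisted_op v u) (twisted_op v w).
Proof.
apply: val_inj; case: u v w => [[x a] /= _] [[y b] /= _] [[z c] /= _].
rewrite /twisted_val /lambda /= !invgK cs_eq; congr pair.
have PhiE s t : Phi (s ∗ t) (s ∗ z) = gm_act A (Phi t z) (sigma s).
  by rewrite -!sigmaE hPhi.2 ?mem_sigma.
rewrite !PhiE -!(gm_actD (mem_sigma _)) -!actMin ?mem_sigma //.
rewrite addrAC; congr (gm_act A _ _).
by apply/permP => t; rewrite !permM !sigmaE cs_eq.
Qed.

Lemma twisted_bij u : bijective (twisted_op u).
Proof.
apply: injF_bij => v w /(congr1 val).
case: u v w => [[x a] /= _] [[y b] /= hb] [[z c] /= hc].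
case=> /(bij_inj (cs_bij x)) eyz /act_inj e; apply: val_inj => /=.
by move: e; rewrite /= eyz => /addIr ->.
Qed.

Lemma twisted_diag_bij : bijective (fun u => twisted_op u u).
Proof.
apply: injF_bij => v w /(congr1 val).
case: v w => [[y b] /= hb] [[z c] /= hc].
case=> /(bij_inj (cs_diag_bij X)) eyz e; apply: val_inj => /=.
by move: e; rewrite eyz => /act_inj /addIr ->.
Qed.

Definition twisted_ext : cycleSet :=
  CycleSet twisted_eq twisted_bij twisted_diag_bij.

Definition twisted_pr (u : twisted_ext) : X := (val (u : scattering)).1.

Lemma twisted_pr_extension : extension twisted_pr.
Proof.
split=> [u v // | x | u v euv].
  by exists (Sub (x, 0) (gm_comp_closed A x).1 : scattering).
apply/permP => w; rewrite !sigmaE; apply: val_inj.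
by move: euv; rewrite /twisted_pr /= /twisted_val => ->.
Qed.

End TwistedExtension.

(* Main.v *)
Require Import Defs.
From mathcomp Require Import all_boot all_algebra all_fingroup.
From mathcomp Require Import all_solvable.

(* The permutations u |-> u * sigma (u x) of Sym(Z) commute and generate an   *)
(* abelian group having the permutation group of the cycle set Z as an orbit  *)
(* (this is its brace structure). Two things follow. First, the kernel K of   *)
(* G(Y) -> G(X) is abelian; as n = |Y|/|X| is prime to m = |G(X)|, it acts    *)
(* transitively on the fibers of f, hence has an exponent dividing n.         *)
(* Second, the permutation mu_y of the m-th additive multiple of y lies in K, *)
(* and mu_(g y) = mu_y ^ g. Dividing each sigma_y by the m-th root shift_y of *)
(* mu_y in K gives a second cycle set on Y, whose m-th multiples act          *)
(* trivially, so that the order of its permutation group H has only prime     *)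
(* divisors of m, and G(Y) is the semidirect product of K and H. By the       *)
(* Schur-Zassenhaus theorem f has an H-invariant section s. Let A_x be the    *)
(* group that K induces on the fiber of x, with G(X) = H acting by            *)
(* conjugation: then (x, a) |-> a (s x) identifies the scattering of A with   *)
(* Y, with twist Phi x y the restriction of shift_(s x) to the fiber of y,    *)
(* which is equivariant because the shifts are.                               *)

Set Implicit Arguments.
Unset Strict Implicit.
Unset Printing Implicit Defensive.

Import FiniteModule.
Local Open Scope group_scope.
Local Open Scope cycle_set_scope.

(** Each fiber of [f] is a torsor under the abelian group that the kernel [K] of [G(Y) -> G(X)]
    induces on it ([ker_push_abelian], [ker_push_fiber_trans]), so it remains to choose origins
    [s x] compatibly with the action. Since [K] has order prime to the order m of [G(X)]
    ([coprime_ker_push]), m-th roots exist in [K]. They split each [sigma y] into an equivariant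
    factor in [K], which becomes the twist ([shiftJ]), and a factor in a complement [H] of [K]
    ([coprime_unshift], [ker_unshift_mulg]). [H] preserves a choice of origins ([unshift_section]),
    and [twisted_point_hom] reads the operation of [Y] in the resulting coordinates. *)

(** * Preliminaries on finite groups *)

Lemma gen_mulr_ind (gT : finGroupType) (A : {set gT}) (P : gT -> Prop) :
  P 1 -> (forall u a, a \in A -> P u -> P (u * a)) ->
  forall u, u \in <<A>> -> P u.
Proof.
move=> P1 PM _ /gen_prodgP[n [c cA ->]].
elim: n c cA => [|n IHn] c cA; first by rewrite big_ord0.
by rewrite big_ord_recr /=; apply: PM; [apply: cA | apply: IHn => i; apply: cA].
Qed.

(** The stabilizer of [x] is normal, and its quotient has the length of the orbit as order. *)
Lemma expg_card_orbit_fix (T : finType) (G : {group {perm T}}) (g : {perm T})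
    (x : T) :
  abelian G -> g \in G -> (g ^+ #|orbit 'P G x|) x = x.
Proof.
move=> abG Gg; set S := 'C_G[x | 'P].
have nSG : S <| G by rewrite /normal subsetIl sub_abelian_norm // subsetIl.
have Ng : g \in 'N(S) by apply: (subsetP (normal_norm nSG)).
have : g ^+ #|orbit 'P G x| \in S.
  apply: coset_idr; rewrite ?groupX // morphX // card_orbit.
  by rewrite -card_quotient ?normal_norm // expg_cardG // mem_quotient.
by case/setIP=> _ /astab1P.
Qed.

Lemma card_abelian_gen_pnat (gT : finGroupType) (A : {set gT}) n :
  0 < n -> abelian <<A>> -> {in A, forall a, a ^+ n = 1} ->
  \pi(n).-nat #|<<A>>|.
Proof.
move=> n_gt0 abA An.
have: (exponent <<A>> %| n)%N.
  rewrite abelian_exponent_gen; last by rewrite -abelian_gen.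
  by apply/exponentP=> a; apply: An.
move=> dvn; rewrite -[_.-nat _]pnat_exponent.
exact: pnat_dvd dvn (pnat_pi n_gt0).
Qed.

(** [M] splits over [K :&: M], with complement [C] say; then [C] and [H :&: K * M] are both
    complements of [K] in [K * M], hence conjugate under [K]. *)
Lemma SchurZassenhaus_compl_conj_sub (gT : finGroupType)
    (G K H M : {group gT}) :
  K <| G -> solvable K -> K * H = G -> coprime #|K| #|H| -> M \subset G ->
  exists2 x, x \in K & (H :&: K * M) :^ x \subset M.
Proof.
move=> nsKG solK defG coKH sMG; have [sKG nKG] := andP nsKG.
have sHG : H \subset G by rewrite -defG mulG_subr.
have nKM := subset_trans sMG nKG; have nKH := subset_trans sHG nKG.
have oGK : #|G / K| = #|H|.
  by rewrite -defG quotientMidl -(card_isog (quotient_isog nKH _)) ?coprime_TIg.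
have hallM : Hall M (K :&: M).
  rewrite /Hall subsetIr (coprimeSg (subsetIl K M)) //.
  rewrite -card_quotient; last by rewrite normsI ?normG.
  rewrite (card_isog (second_isog nKM)) (coprime_dvdr _ coKH) //.
  by rewrite -oGK cardSg // quotientS.
have nsKM : K :&: M <| M by rewrite /normal subsetIr normsI ?normG.
have /splitsP[C /complP[tiC defM]] := SchurZassenhaus_split hallM nsKM.
have sCM : C \subset M by rewrite -defM mulG_subr.
have KCE : K <*> C = K * C by apply: norm_joinEr (subset_trans sCM nKM).
have KME : K * M = K * C by rewrite -defM mulgA (mulGSid (subsetIl K M)).
have tiKC : K :&: C = 1.
  by apply/trivgP; rewrite -tiC -setIA (setIidPr sCM).
pose L := (H :&: (K <*> C))%G.
have KLE : K * L = K * C.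
  rewrite /= group_modl ?joing_subl // defG -KCE; apply/setIidPr.
  by rewrite join_subG sKG (subset_trans sCM).
have tiKL : K :&: L = 1.
  by apply/trivgP; rewrite -(coprime_TIg coKH) setIS ?subsetIl.
have oC : #|C| = #|L|.
  apply/eqP; rewrite -(eqn_pmul2l (cardG_gt0 K)) -!TI_cardMg //.
  by rewrite KLE.
have [|||x Kx CE] := SchurZassenhaus_trans_sol solK _ _ _ oC.
- by rewrite subIset // nKH.
- by rewrite KLE mulG_subr.
- exact: coprimegS (subsetIl _ _) coKH.
have sLM : L :^ x \subset M by rewrite -CE.
by exists x; rewrite // KME -KCE.
Qed.

(** * Additive structure of the permutation group *)

Section SigmaIter.
Variable Z : cycleSet.
Implicit Types (x y z : Z) (u v : {perm Z}).

(* The inverse of the permutation by which the multiple k x in the additive *)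
(* group of the structure brace acts, with k x the product of the k terms   *)
(* x, x ∗ x, (x ∗ x) ∗ (x ∗ x), ...                                         *)
Fixpoint sigman k x : {perm Z} :=
  if k is k'.+1 then sigma x * sigman k' (x ∗ x) else 1.

Lemma sigman_exchange k x z :
  sigma z * sigman k (z ∗ x) = sigman k x * sigma (sigman k x z).
Proof.
elim: k x z => [|k IHk] x z; first by rewrite mulg1 mul1g perm1.
have cycle : sigma z * sigma (z ∗ x) = sigma x * sigma (x ∗ z).
  by apply/permP=> w; rewrite !permM !sigmaE cs_eq.
by rewrite /= mulgA cycle cs_eq -!mulgA (IHk (x ∗ x)) !permM sigmaE.
Qed.

(* The addition of a generator in the brace structure of the permutation *)
(* group, transported by inversion.                                      *)
Definition add_sigma x u := u * sigma (u x).

Lemma add_sigma_inj x : injective (add_sigma x).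
Proof.
move=> u v euv; have euvx : u x = v x.
  apply: (bij_inj (cs_diag_bij Z)).
  by have := congr1 (fun w : {perm Z} => w x) euv; rewrite !permM !sigmaE.
by move: euv; rewrite /add_sigma euvx => /mulIg.
Qed.

Definition translation x : {perm {perm Z}} := perm (@add_sigma_inj x).

Lemma translationE x u : translation x u = u * sigma (u x).
Proof. by rewrite permE. Qed.

Lemma translation_exp k x u : (translation x ^+ k) u = u * sigman k (u x).
Proof.
elim: k u => [|k IHk] u; first by rewrite expg0 perm1 mulg1.
by rewrite expgS permM IHk translationE /= permM sigmaE mulgA.
Qed.

Definition translation_group := <<[set translation x | x : Z]>>%G.

Lemma translation_group_abelian : abelian translation_group.
Proof.
rewrite /= abelian_gen; apply/centsP=> _ /imsetP[x _ ->] _ /imsetP[z _ ->].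
apply/permP=> u; rewrite !permM !translationE !permM !sigmaE -!mulgA.
by congr (u * _); apply/permP=> w; rewrite !permM !sigmaE cs_eq.
Qed.

(** At [u], translation by [u^-1 y] is right multiplication by [sigma y]. *)
Lemma orbit_translation_group :
  orbit 'P translation_group 1 = perm_group Z.
Proof.
have tP x : translation x \in translation_group by apply/mem_gen/imset_f.
apply/eqP; rewrite eqEsubset; apply/andP; split.
  rewrite acts_sub_orbit ?group1 //.
  rewrite /= gen_subG; apply/subsetP=> _ /imsetP[x _ ->].
  rewrite !inE; apply/subsetP=> u Gu; rewrite inE /= apermE translationE.
  by rewrite groupM ?mem_sigma.
apply/subsetP; apply: gen_mulr_ind => [|u _ /imsetP[y _ ->] uO].
  exact: orbit_refl.
have := mem_orbit 'P u (tP (u^-1 y)); move/orbit_trans/(_ uO).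
by rewrite /= apermE translationE permKV.
Qed.

(** In an abelian group, the power by the length of the orbit of 1 fixes 1, and [translation x ^+ k]
    sends 1 to [sigman k x]. *)
Lemma sigman_card_perm_group x : sigman #|perm_group Z| x = 1.
Proof.
have := @expg_card_orbit_fix _ translation_group (translation x) 1
  translation_group_abelian.
rewrite orbit_translation_group translation_exp mul1g perm1; apply.
exact/mem_gen/imset_f.
Qed.

Lemma perm_group_pnat n :
  0 < n -> (forall x, sigman n x = 1) -> \pi(n).-nat #|perm_group Z|.
Proof.
move=> n_gt0 sn1; rewrite -orbit_translation_group.
apply: pnat_dvd (dvdn_orbit _ _ _) _.
apply: card_abelian_gen_pnat => //; first exact: translation_group_abelian.
move=> _ /imsetP[x _ ->]; apply/permP=> u.
by rewrite translation_exp sn1 mulg1 perm1.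
Qed.

End SigmaIter.

Lemma mem_sigman (Z : cycleSet) k (x : Z) : sigman k x \in perm_group Z.
Proof.
by elim: k x => [|k IHk] x; rewrite /= ?group1 // groupM ?mem_sigma.
Qed.

Lemma indecomposable_transitive (Z : cycleSet) (x y : Z) :
  indecomposable Z -> y \in orbit 'P (perm_group Z) x.
Proof.
move=> indZ; apply/negPn/negP=> nxy; apply: indZ.
have sub (S : {set Z}) : [acts perm_group Z, on S | 'P] -> sub_cycle_set S.
  move=> aS u v Su Sv; rewrite -sigmaE -[sigma u v]/('P%act v (sigma u)).
  by rewrite (acts_act aS) ?mem_sigma.
have aO : [acts perm_group Z, on orbit 'P (perm_group Z) x | 'P].
  by apply: acts_orbit; apply: subsetT.
exists (orbit 'P (perm_group Z) x); split; last 2 [exact: sub].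
- by apply/set0Pn; exists x; apply: orbit_refl.
- by apply/set0Pn; exists y; rewrite inE.
by apply: sub; rewrite astabsC.
Qed.

(** * The homomorphism of permutation groups induced by an extension *)

Section Extension.
Variables (X Y : cycleSet) (f : Y -> X).
Hypothesis ext_f : extension f.

Let fM : cs_hom f. Proof. by case: ext_f. Qed.
Let f_surj x : exists y, f y = x. Proof. by case: ext_f. Qed.
Let f_sigma y z : f y = f z -> sigma y = sigma z.
Proof. by case: ext_f => _ _; apply. Qed.

(** The search makes the map total; on [perm_group Y] it always succeeds, so the default 1 never
    matters there. *)
Definition push (h : {perm Y}) : {perm X} :=
  odflt 1 [pick g : {perm X} | [forall y, f (h y) == g (f y)]].

Lemma push_uniq (h : {perm Y}) (g : {perm X}) :
  (forall y, f (h y) = g (f y)) -> push h = g.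
Proof.
move=> hg; rewrite /push; case: pickP => [g' /forallP g'P | /(_ g)/forallP[] y].
  by apply/permP=> x; have [y <-] := f_surj x; rewrite -hg; apply/esym/eqP.
exact/eqP.
Qed.

Lemma push_sigma y : push (sigma y) = sigma (f y).
Proof. by apply: push_uniq => z; rewrite !sigmaE fM. Qed.

Lemma pushE_mem h : h \in perm_group Y ->
  (forall y, f (h y) = push h (f y)) /\ push h \in perm_group X.
Proof.
move: h; apply: gen_mulr_ind => [|h _ /imsetP[y _ ->] [hE Gh]].
  by rewrite (@push_uniq _ 1) => [|y]; rewrite ?group1 ?perm1; split=> // y;
     rewrite !perm1.
have hyE z : f ((h * sigma y) z) = (push h * sigma (f y)) (f z).
  by rewrite !permM !sigmaE fM hE.
by rewrite (push_uniq hyE); split=> //; rewrite groupM ?mem_sigma.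
Qed.

Lemma pushE h y : h \in perm_group Y -> f (h y) = push h (f y).
Proof. by case/pushE_mem. Qed.

Lemma pushM : {in perm_group Y &, {morph push : g h / g * h}}.
Proof.
by move=> g h Gg Gh; apply: push_uniq => y; rewrite !permM !pushE.
Qed.

Canonical push_morphism := Morphism pushM.

Lemma im_push : push @* perm_group Y = perm_group X.
Proof.
apply/eqP; rewrite eqEsubset; apply/andP; split.
  by apply/subsetP=> _ /morphimP[h _ /pushE_mem[_ Gh] ->].
rewrite gen_subG; apply/subsetP=> _ /imsetP[x _ ->].
have [y <-] := f_surj x; rewrite -push_sigma.
by apply: mem_morphim; apply: mem_sigma.
Qed.

Lemma ker_pushP k :
  reflect (k \in perm_group Y /\ forall y, f (k y) = f y) (k \in 'ker push).
Proof.
apply: (iffP idP) => [Kk | [Gk kf]].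
  have Gk := dom_ker Kk; split=> // y.
  by rewrite pushE // (mker Kk) perm1.
by apply/kerP=> //; apply: push_uniq => y; rewrite perm1.
Qed.

Lemma sigman_fiber k y z : f y = f z -> sigman k y = sigman k z.
Proof.
elim: k y z => //= k IHk y z fyz; rewrite (f_sigma fyz); congr (_ * _).
by apply: IHk; rewrite !fM fyz.
Qed.

Lemma push_sigman k y : push (sigman k y) = sigman k (f y).
Proof.
elim: k y => [|k IHk] y /=; first exact: (morph1 push_morphism).
by rewrite pushM ?mem_sigma ?mem_sigman // push_sigma IHk fM.
Qed.

(* Left multiplication by an element of the kernel commutes with the         *)
(* translations, hence coincides on the permutation group with an element of *)
(* the abelian group that they generate.                                     *)
Lemma ker_push_abelian : abelian ('ker push).
Proof.
have comm k s : k \in 'ker push -> s \in translation_group Y ->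
    s 1 \in perm_group Y /\ s k = k * s 1.
  move=> /ker_pushP[Gk kf]; move: s; apply: gen_mulr_ind.
    by rewrite !perm1 group1 mulg1.
  move=> s _ /imsetP[y _ ->] [Gs1 skE]; rewrite !permM skE !translationE.
  rewrite groupM ?mem_sigma // -mulgA; split=> //; do 2!congr (_ * _).
  by apply: f_sigma; rewrite permM !pushE // -pushE // kf.
have orb k : k \in 'ker push -> exists2 s, s \in translation_group Y & s 1 = k.
  case/ker_pushP; rewrite -orbit_translation_group => /orbitP[s Ts <-] _.
  by exists s.
apply/centsP=> k Kk k' Kk'; have [s Ts s1] := orb k Kk.
have [s' Ts' s1'] := orb k' Kk'; have [_] := comm k s' Kk Ts'.
have [_] := comm k' s Kk' Ts; rewrite s1 s1' /commute => <- <-.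
rewrite -s1 -{1}s1' -!permM.
by rewrite (centsP (translation_group_abelian Y) s Ts s' Ts').
Qed.

Lemma card_perm_group_ext :
  #|perm_group Y| = (#|'ker push| * #|perm_group X|)%N.
Proof.
have /card_isog := first_isog push_morphism; rewrite /= im_push => <-.
by rewrite card_quotient ?ker_norm // Lagrange // subsetIl.
Qed.

End Extension.

(** * The kernel of a coprime extension *)

Section CoprimeExtension.
Variables (X Y : cycleSet) (f : Y -> X).
Hypothesis cop_f : coprime_extension f.

Let ext_f : extension f. Proof. by case: cop_f. Qed.
Let fM : cs_hom f. Proof. by case: ext_f. Qed.
Let f_surj x : exists y, f y = x. Proof. by case: ext_f. Qed.
Let f_sigma y z : f y = f z -> sigma y = sigma z.
Proof. by case: ext_f => _ _; apply. Qed.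

Local Notation G := (perm_group Y).
Local Notation m := #|perm_group X|.
Local Notation K := ('ker (push_morphism ext_f))%G.

Let transG y z : exists2 g, g \in G & g y = z.
Proof.
have [_ indY _ _] := cop_f.
by have /orbitP := indecomposable_transitive y z indY.
Qed.

Let sKG : K \subset G. Proof. exact: subsetIl. Qed.

Lemma card_fiber y : #|Y| = (#|[set z | f z == f y]| * #|X|)%N.
Proof.
rewrite -[LHS]sum1_card (partition_big f predT) //= mulnC -sum_nat_const.
apply: eq_bigr => x _; rewrite sum1_card.
have [z fz] := f_surj x; have [g Gg gy] := transG y z.
rewrite -[RHS](card_imset _ (@perm_inj _ g)); apply: eq_card => w.
rewrite unfold_in; apply/eqP/imsetP => [fw | [v]].
  exists (g^-1 w); last by rewrite permKV.
  rewrite inE; apply/eqP; apply: (@perm_inj _ (push f g)).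
  by rewrite -!(pushE ext_f) // permKV gy fz.
by rewrite inE => /eqP fv ->; rewrite (pushE ext_f) // fv -(pushE ext_f) // gy.
Qed.

(** The orbit lies in a fiber, which has n points. Conversely, with [M] the stabilizer of [y], the
    index q of [K <*> M] in [G] divides m, and q times the orbit length is [#|Y|], a multiple of n;
    as n is prime to q, it divides the orbit length. *)
Lemma card_orbit_ker y : #|orbit 'P K y| = (#|Y| %/ #|X|)%N.
Proof.
have X_gt0 : 0 < #|X| by apply/card_gt0P; exists (f y).
have [_ _ _ co] := cop_f; set n := (_ %/ _)%N in co *.
have nE : #|Y| = (n * #|X|)%N by rewrite /n (card_fiber y) mulnK.
have fibE : #|[set z | f z == f y]| = n by rewrite /n (card_fiber y) mulnK.
apply/eqP; rewrite eqn_leq -{1}fibE subset_leq_card /=; last first.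
  apply/subsetP=> _ /orbitP[k /ker_pushP[_ kf] <-].
  by rewrite inE /= apermE kf.
apply: dvdn_leq; first by apply/card_gt0P; exists y; apply: orbit_refl.
set M := 'C_G[y | 'P].
have oM : (#|Y| * #|M|)%N = #|G|.
  suff oT : orbit 'P G y = setT by rewrite -(card_orbit_stab 'P G y) oT cardsT.
  apply/setP=> z; rewrite inE; have [g Gg <-] := transG y z.
  exact: (mem_orbit 'P).
have oKy : (#|orbit 'P K y| * #|K :&: M|)%N = #|K|.
  by rewrite -(card_orbit_stab 'P K y) setIA (setIidPl sKG).
have nKM : M \subset 'N(K).
  by apply: subset_trans (ker_norm (push_morphism ext_f)); apply: subsetIl.
have oKM : #|K <*> M| = (#|orbit 'P K y| * #|M|)%N.
  apply/eqP; rewrite norm_joinEr // -(eqn_pmul2r (cardG_gt0 (K :&: M))).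
  by rewrite -mul_cardG mulnAC oKy.
have /dvdnP[q oG] : #|K <*> M| %| #|G|.
  by apply: cardSg; rewrite join_subG sKG subsetIl.
have /dvdnP[d oK] : #|K| %| #|K <*> M| by apply/cardSg/joing_subl.
have q_m : q %| m.
  apply/dvdnP; exists d; apply/eqP; rewrite -(eqn_pmul2l (cardG_gt0 K)).
  by rewrite -(card_perm_group_ext ext_f) oG oK mulnA mulnC [(q * d)%N]mulnC.
have : n %| q * #|orbit 'P K y|.
  apply/dvdnP; exists #|X|; apply/eqP; rewrite -(eqn_pmul2r (cardG_gt0 M)).
  by rewrite -mulnA -oKM -oG -oM nE [(_ * n)%N]mulnC.
by rewrite Gauss_dvdr // coprime_sym (coprime_dvdl q_m).
Qed.

Lemma ker_push_fiber_trans y z : f y = f z -> exists2 k, k \in K & k y = z.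
Proof.
move=> fyz; suff: z \in orbit 'P K y by case/orbitP => k; exists k.
have X_gt0 : 0 < #|X| by apply/card_gt0P; exists (f y).
have -> : orbit 'P K y = [set z | f z == f y]; last by rewrite inE fyz.
apply/eqP; rewrite eqEcard card_orbit_ker (card_fiber y) mulnK // leqnn andbT.
apply/subsetP=> _ /orbitP[k /ker_pushP[_ kf] <-].
by rewrite inE /= apermE kf.
Qed.

(** All [K]-orbits have n points, so [K] has exponent dividing n; by Cauchy, a prime common to
    [#|K|] and m would divide n. *)
Lemma coprime_ker_push : coprime #|K| m.
Proof.
have [_ _ _ co] := cop_f; set n := (_ %/ _)%N in co.
have Kn k : k \in K -> k ^+ n = 1.
  move=> Kk; apply/permP=> y; rewrite perm1 /n -(card_orbit_ker y).
  exact: expg_card_orbit_fix (ker_push_abelian ext_f) Kk.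
rewrite (coprime_pi' (cardG_gt0 K) (cardG_gt0 _)); apply/pnatP=> // p p_pr p_m.
apply/negP; rewrite mem_primes => /and3P[_ _ /(Cauchy p_pr)[k /Kn kn kp]].
have p_n : p %| n by rewrite -kp order_dvdn kn.
have: (p %| gcdn m n)%N by rewrite dvdn_gcd p_m p_n.
by rewrite (eqP co) dvdn1; case: eqP p_pr => // ->.
Qed.

(** * Shifts, and the second cycle set on [Y] *)

Definition shift y : {perm Y} := sigman m y ^+ expg_invn K m.

Lemma sigman_ker y : sigman m y \in K.
Proof.
apply/kerP; first exact: mem_sigman.
exact: etrans (push_sigman ext_f _ _) (sigman_card_perm_group _).
Qed.

Lemma shift_ker y : shift y \in K.
Proof. by rewrite groupX ?sigman_ker. Qed.

Lemma shift_expg y : shift y ^+ m = sigman m y.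
Proof.
by rewrite -expgnA mulnC expgnA (expgK coprime_ker_push) ?sigman_ker.
Qed.

Lemma shift_fiber y z : f y = f z -> shift y = shift z.
Proof. by move=> fyz; rewrite /shift (sigman_fiber ext_f _ fyz). Qed.

(** For a generator [sigma z] this is [sigman_exchange]: [sigman m y] preserves fibers, so it moves
    [z] to a point with the same [sigma]. *)
Lemma shiftJ g y : g \in G -> shift (g y) = shift y ^ g.
Proof.
move: g; apply: gen_mulr_ind => [|g _ /imsetP[z _ ->] IHg].
  by rewrite perm1 conjg1.
rewrite permM conjgM -{}IHg; move: (g y) => {g}y.
rewrite sigmaE /shift conjXg; congr (_ ^+ _).
apply: (mulgI (sigma z)); rewrite sigman_exchange -conjgC; congr (_ * _).
by apply: f_sigma; have /ker_pushP[_] := sigman_ker y.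
Qed.

Lemma shift_op y z : shift (y ∗ z) = shift z ^ sigma y.
Proof. by rewrite -sigmaE shiftJ ?mem_sigma. Qed.

(* Removing the shifts from the left multiplications turns Y into another *)
(* extension of X, whose permutation group is a complement of the kernel. *)
Definition unshift_perm y := (shift y)^-1 * sigma y.
Definition unshift_op y z := unshift_perm y z.

Lemma f_unshift y z : f (unshift_perm y z) = f y ∗ f z.
Proof.
have /ker_pushP[_ kf] := groupVr (shift_ker y).
by rewrite permM sigmaE fM kf.
Qed.

Lemma unshift_fiber y z : f y = f z -> unshift_perm y = unshift_perm z.
Proof.
by move=> fyz; rewrite /unshift_perm (shift_fiber fyz) (f_sigma fyz).
Qed.

(** Only the fiber of [w] matters, so [w] may be taken to be [y ∗ z]. Both factors on the right are
    symmetric in [y] and [z], whence the cycle set equation. *)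
Lemma unshift_mul y z w : f w = f y ∗ f z ->
  unshift_perm y * unshift_perm w
  = (shift y * shift z)^-1 * (sigma y * sigma (y ∗ z)).
Proof.
rewrite -fM => /unshift_fiber ->; rewrite /unshift_perm shift_op -conjVg.
rewrite (centsP (ker_push_abelian ext_f) (shift y)) ?shift_ker // invMg.
by rewrite conjgE !mulgA mulgK.
Qed.

Lemma unshift_eq x y z : unshift_op (unshift_op x y) (unshift_op x z)
  = unshift_op (unshift_op y x) (unshift_op y z).
Proof.
rewrite /unshift_op -!permM.
rewrite (unshift_mul (f_unshift _ _)) (unshift_mul (f_unshift _ _)).
rewrite (centsP (ker_push_abelian ext_f) (shift y)) ?shift_ker //.
congr (fun_of_perm (_ * _) _).
by apply/permP=> w; rewrite !permM !sigmaE cs_eq.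
Qed.

Lemma unshift_bij y : bijective (unshift_op y).
Proof. by apply: injF_bij => z w; apply: perm_inj. Qed.

Lemma unshift_diag_bij : bijective (fun y => unshift_op y y).
Proof.
apply: injF_bij => y z e; have fyz : f y = f z.
  by apply: (bij_inj (cs_diag_bij X)); rewrite -!f_unshift -/(unshift_op _ _) e.
by move: e; rewrite /unshift_op (unshift_fiber fyz) => /perm_inj.
Qed.

Definition unshift := CycleSet unshift_eq unshift_bij unshift_diag_bij.
Local Notation H := (perm_group unshift).

Lemma sigma_unshift (y : Y) : @sigma unshift y = unshift_perm y.
Proof. by apply/permP=> z; rewrite sigmaE. Qed.

Lemma unshift_ext : extension (f : unshift -> X).
Proof.
split=> // [y z | y z fyz]; first exact: f_unshift.
by rewrite !sigma_unshift (unshift_fiber fyz).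
Qed.

Lemma unshift_sub : H \subset G.
Proof.
rewrite gen_subG; apply/subsetP=> _ /imsetP[y _ ->].
rewrite sigma_unshift groupM //; last exact: (mem_sigma (y : Y)).
by rewrite groupV (subsetP sKG) // shift_ker.
Qed.

Lemma sigman_unshift k (y : Y) :
  @sigman unshift k y = (shift y)^- k * sigman k y.
Proof.
elim: k y => [|k IHk] y /=; first by rewrite invg1 mulg1.
have fT : f (unshift_op y y) = f (y ∗ y) by rewrite f_unshift fM.
rewrite (sigman_fiber unshift_ext k fT) IHk sigma_unshift.
rewrite /unshift_perm shift_op.
by rewrite -conjXg -conjVg conjgE !mulgA mulgK -invMg -expgSr.
Qed.

(** The m-th multiples of the new cycle set act trivially, so [H] involves only primes dividing
    m. *)
Lemma coprime_unshift : coprime #|K| #|H|.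
Proof.
apply: (@pnat_coprime \pi(m)^').
  by rewrite -coprime_pi' // coprime_sym coprime_ker_push.
rewrite pnatNK; apply: perm_group_pnat => // y.
by rewrite sigman_unshift shift_expg mulVg.
Qed.

Lemma ker_unshift_mulg : K * H = G.
Proof.
have nKH : H \subset 'N(K).
  by apply: subset_trans unshift_sub (ker_norm (push_morphism ext_f)).
have KHE : K <*> H = K * H by apply: norm_joinEr.
apply/eqP; rewrite eqEsubset mulG_subG sKG unshift_sub -KHE gen_subG.
apply/subsetP=> _ /imsetP[y _ ->]; rewrite -[sigma y](mulKVg (shift y)).
rewrite groupM //.
  by rewrite (subsetP (joing_subl _ _)) ?shift_ker.
apply: (subsetP (joing_subr _ _)); rewrite -/(unshift_perm y) -sigma_unshift.
exact: (@mem_sigma unshift).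
Qed.

(** * An invariant section from Schur-Zassenhaus *)

(** As [K] is transitive on fibers, the elements of [H] preserving the fiber of [y] lie in [K * M],
    with [M] the stabilizer of [y]; some [x] in [K] conjugates them into [M], so they fix
    [x^-1 y]. *)
Lemma fiber_unshift_fix y : exists2 z, f z = f y &
  forall h, h \in H -> f (h z) = f z -> h z = z.
Proof.
have nsKG : K <| G := ker_normal (push_morphism ext_f).
have [] := SchurZassenhaus_compl_conj_sub nsKG
  (abelian_sol (ker_push_abelian ext_f)) ker_unshift_mulg coprime_unshift
  (subsetIl G 'C[y | 'P]).
set M := 'C_G[y | 'P]; move=> x Kx sHM.
have nKM : K * M = M * K.
  apply/esym; apply: normC.
  exact: subset_trans (subsetIl _ _) (normal_norm nsKG).
exists (x^-1 y) => [|h Hh fh].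
  by have /ker_pushP[_ ->] := groupVr Kx.
have [Gh fx] : h \in G /\ f (x^-1 y) = f y.
  by split; [apply: subsetP Hh; apply: unshift_sub
            | have /ker_pushP[_ ->] := groupVr Kx].
have /ker_push_fiber_trans[k Kk ky] : f y = f (h y).
  by rewrite (pushE ext_f) // -fx -(pushE ext_f) // fh.
have Mhk : h * k^-1 \in M.
  rewrite inE groupM ?groupV ?(subsetP sKG k) //=.
  by apply/astab1P; rewrite /= apermE permM -ky permK.
have : h ^ x \in M.
  apply: (subsetP sHM); rewrite memJ_conjg inE Hh /= nKM.
  by rewrite -[h](mulgKV k) mem_mulg.
case/setIP=> _ /astab1P; rewrite /= apermE conjgE !permM => xhy.
by rewrite -[in RHS]xhy permK.
Qed.

(** The [H]-orbit of a point from [fiber_unshift_fix] meets every fiber because [K * H = G], and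
    only once because of the fixed point property; it is the image of [s]. *)
Lemma unshift_section : exists s : X -> Y, cancel s f /\
  forall h x, h \in H -> h (s x) = s (push f h x).
Proof.
(* An empty [Y] has no point to start from, but is indecomposable in the formal sense. *)
have [y0 _ | Y0] := pickP (@predT Y); last first.
  have [s sK] := fin_all_exists f_surj.
  by exists s; split=> // h x; have := Y0 (s x).
have [z _ zfix] := fiber_unshift_fix y0.
have sP x : exists y, f y = x /\ y \in orbit 'P H z.
  have [y <-] := f_surj x; have [g] := transG z y.
  rewrite -ker_unshift_mulg => /mulsgP[k h Kk Hh ->] <-.
  exists (h z); split; last exact: (mem_orbit 'P).
  have Gh : h \in G by apply: subsetP Hh; apply: unshift_sub.
  by rewrite permM !(pushE ext_f _ Gh); have /ker_pushP[_ ->] := Kk.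
have [s sE] := fin_all_exists sP; exists s; split=> [x | h x Hh].
  by have [] := sE x.
have HG a : a \in H -> a \in G by apply: subsetP; apply: unshift_sub.
have [fs1 /orbitP[a Ha sx]] := sE x.
have [fs2 /orbitP[b Hb sgx]] := sE (push f h x).
(* This element of [H] brings [z] back to its own fiber. *)
have /(congr1 b) : (a * h * b^-1) z = z.
  apply: zfix; first by rewrite !groupM ?groupV.
  apply: (@perm_inj _ (push f b)); rewrite -!(pushE ext_f _ (HG _ Hb)).
  move: sx sgx; rewrite /= !apermE !permM permKV => -> ->.
  by rewrite fs2 (pushE ext_f) ?fs1 // HG.
by move: sx sgx; rewrite /= !apermE !permM permKV => -> ->.
Qed.

(** * The module graded by the fibers *)

Let ker_f k y : k \in K -> f (k y) = f y.
Proof. by case/ker_pushP. Qed.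

(* The direct product of the groups of permutations that the kernel induces *)
(* on the fibers.                                                           *)
Definition fiber_ker_set : {set {perm Y}} :=
  [set b : {perm Y} | [forall x, [exists k in K,
     [forall y, (f y == x) ==> (b y == k y)]]]].

Lemma fiber_kerP (b : {perm Y}) :
  reflect (forall x, exists2 k, k \in K & forall y, f y = x -> b y = k y)
          (b \in fiber_ker_set).
Proof.
rewrite inE; apply: (iffP forallP) => bP x.
  have /exists_inP[k Kk /forallP kP] := bP x; exists k => // y fy.
  by apply/eqP; rewrite (implyP (kP y)) // fy.
have [k Kk kP] := bP x; apply/exists_inP; exists k => //.
by apply/forallP=> y; apply/implyP=> /eqP/kP->.
Qed.

Lemma fiber_ker_f (b : {perm Y}) y : b \in fiber_ker_set -> f (b y) = f y.
Proof. by case/fiber_kerP/(_ (f y)) => k Kk -> //; apply: ker_f. Qed.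

Lemma ker_fiber_ker k : k \in K -> k \in fiber_ker_set.
Proof. by move=> Kk; apply/fiber_kerP=> x; exists k. Qed.

Lemma fiber_ker_group_set : group_set fiber_ker_set.
Proof.
apply/group_setP; split=> [|b c Bb Bc]; first exact/ker_fiber_ker/group1.
apply/fiber_kerP=> x; have /fiber_kerP/(_ x)[k Kk kP] := Bb.
have /fiber_kerP/(_ x)[l Kl lP] := Bc; exists (k * l); first exact: groupM.
by move=> y fy; rewrite !permM kP // lP // ker_f.
Qed.

Canonical fiber_ker := Group fiber_ker_group_set.

Lemma fiber_ker_abelian : abelian fiber_ker.
Proof.
apply/centsP=> b Bb c Bc; apply/permP=> y; rewrite !permM.
have /fiber_kerP/(_ (f y))[k Kk kP] := Bb.
have /fiber_kerP/(_ (f y))[l Kl lP] := Bc.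
rewrite kP // [in RHS]lP // lP ?ker_f // kP ?ker_f // -!permM.
by rewrite (centsP (ker_push_abelian ext_f) k).
Qed.

Lemma fiber_ker_norm : G \subset 'N(fiber_ker).
Proof.
apply/subsetP=> h Gh; rewrite inE; apply/subsetP=> _ /imsetP[b Bb ->].
have Gh' : h^-1 \in G by rewrite groupV.
apply/fiber_kerP=> x; have /fiber_kerP/(_ (push f h^-1 x))[k Kk kP] := Bb.
exists (k ^ h) => [|y fy].
  by rewrite memJ_norm // (subsetP (ker_norm (push_morphism ext_f))).
by rewrite !conjgE !permM kP // (pushE ext_f) ?fy.
Qed.

(** A transitive abelian permutation group is regular. *)
Lemma fiber_ker_eq (b c : {perm Y}) y z : b \in fiber_ker -> c \in fiber_ker ->
  f y = f z -> b y = c y -> b z = c z.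
Proof.
move=> Bb Bc fyz; have /fiber_kerP/(_ (f z))[k Kk kP] := Bb.
have /fiber_kerP/(_ (f z))[l Kl lP] := Bc; rewrite !kP // !lP //.
have [t Kt <-] := ker_push_fiber_trans fyz.
have abK := centsP (ker_push_abelian ext_f); rewrite -!permM => kly.
by rewrite -!(abK _ _ t) // !permM kly.
Qed.

Definition fiber_res (b : {perm Y}) x := restr_perm (f @^-1: [set x]) b.

Lemma fiber_resE b x y : b \in fiber_ker ->
  fiber_res b x y = if f y == x then b y else y.
Proof.
move=> Bb; case: ifP => fy.
  rewrite restr_permE ?inE //; apply/subsetP=> z; rewrite !inE /= apermE.
  by rewrite fiber_ker_f.
by apply: out_perm (restr_perm_on _ _) _; rewrite !inE fy.
Qed.

(** This closure, which [K] itself may lack, is the reason to work with [fiber_ker]: it supplies the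
    homogeneous components. *)
Lemma fiber_res_mem b x : b \in fiber_ker -> fiber_res b x \in fiber_ker.
Proof.
move=> Bb; apply/fiber_kerP=> x'.
have /fiber_kerP/(_ x')[k Kk kP] := Bb.
exists (if x' == x then k else 1); first by case: ifP.
move=> y fy; rewrite fiber_resE // fy; case: ifP => _; first exact: kP.
by rewrite perm1.
Qed.

Lemma fiber_resJ k h x : k \in K -> h \in G ->
  fiber_res (k ^ h) (push f h x) = fiber_res k x ^ h.
Proof.
move=> Kk Gh; have Bk := ker_fiber_ker Kk; apply/permP=> y.
rewrite fiber_resE ?memJ_norm ?(subsetP fiber_ker_norm) //.
rewrite !conjgE !permM fiber_resE // -{1}[y](permKV h) (pushE ext_f) //.
by rewrite (inj_eq (@perm_inj _ _)); case: ifP => // _; rewrite permKV.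
Qed.

Local Notation A := (fmod_of fiber_ker_abelian).
Local Notation fmodA := (fmod fiber_ker_abelian).
Local Notation valA := (@fmval _ _ fiber_ker_abelian).

Definition fmod_comp x : {set A} :=
  [set a | [forall y, (f y != x) ==> (valA a y == y)]].

Lemma fmod_compP x (a : A) :
  reflect (forall y, f y <> x -> valA a y = y) (a \in fmod_comp x).
Proof.
rewrite inE; apply: (iffP forallP) => aP y.
  by move=> /eqP fy; apply/eqP/(implyP (aP y)).
by apply/implyP=> /eqP fy; apply/eqP/aP.
Qed.

Lemma fmod_comp_closed x : GRing.zmod_closed (fmod_comp x).
Proof.
split=> [|a b /fmod_compP aP /fmod_compP bP].
  by apply/fmod_compP=> y _; rewrite fmval0 perm1.
apply/fmod_compP=> y fy; rewrite fmvalA fmvalN permM aP //.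
by rewrite -[in LHS](bP y fy) permK.
Qed.

Lemma fmod_res_comp b x : b \in fiber_ker ->
  fmodA (fiber_res b x) \in fmod_comp x.
Proof.
move=> Bb; apply/fmod_compP=> y /eqP/negPf fy.
by rewrite fmodK ?fiber_res_mem // fiber_resE // fy.
Qed.

Lemma fmval_sum_comp (h : {ffun X -> A}) y :
  (forall x, h x \in fmod_comp x) ->
  valA (\sum_x h x)%R y = valA (h (f y)) y.
Proof.
move=> hP; rewrite (bigD1 (f y)) //= GRing.addrC fmvalA permM.
congr (fun_of_perm _ _); apply: (big_ind (fun a => valA a y = y)).
- by rewrite fmval0 perm1.
- by move=> a b ay bv; rewrite fmvalA permM ay.
- by move=> x /eqP nx; apply: (fmod_compP _ _ (hP x)) => /esym.
Qed.

Lemma fmod_direct_sum (a : A) : exists! h : {ffun X -> A},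
  (forall x, h x \in fmod_comp x) /\ a = (\sum_x h x)%R.
Proof.
have Ba := fmodP a; pose h := [ffun x => fmodA (fiber_res (valA a) x)].
have hP x : h x \in fmod_comp x by rewrite ffunE fmod_res_comp.
have hE x y : valA (h x) y = if f y == x then valA a y else y.
  by rewrite ffunE fmodK ?fiber_res_mem // fiber_resE.
exists h; split=> [|h' [h'P ah']].
  split=> //; apply: val_inj; apply/permP=> y.
  by rewrite [RHS]fmval_sum_comp // hE eqxx.
apply/ffunP=> x; apply: val_inj; apply/permP=> y.
rewrite [LHS]hE; case: eqP => [<- | nfy]; first by rewrite ah' fmval_sum_comp.
by rewrite (fmod_compP _ _ (h'P x)).
Qed.

(** * The action of [G(X)] through the complement *)

Definition unshift_lift (g : {perm X}) : {perm Y} :=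
  odflt 1 [pick h : {perm Y} in H | push f h == g].

Lemma mem_unshift_lift g : unshift_lift g \in H.
Proof.
by rewrite /unshift_lift; case: pickP => [h /andP[] | _]; rewrite ?group1.
Qed.

Let HG h : h \in H -> h \in G. Proof. exact: (subsetP unshift_sub). Qed.

(** Two lifts in [H] differ by an element of [K :&: H], trivial by coprimality. *)
Lemma unshift_lift_push h : h \in H -> unshift_lift (push f h) = h.
Proof.
move=> Hh; rewrite /unshift_lift.
case: pickP => [h' /andP[Hh' /eqP e] | /(_ h)]; last by rewrite Hh eqxx.
have : h * h'^-1 \in K :&: H.
  rewrite inE [in X in _ && X]groupM ?groupV // andbT.
  apply/ker_pushP; split=> [|y]; first by rewrite groupM ?groupV ?HG.
  apply: (@perm_inj _ (push f h')); rewrite -!(pushE ext_f) ?HG //.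
  by rewrite permM permKV !(pushE ext_f) ?HG // e.
rewrite (coprime_TIg coprime_unshift) inE => /eqP/(congr1 (mulg^~ h')).
by rewrite mulgKV mul1g.
Qed.

Lemma unshift_liftK g : g \in perm_group X -> push f (unshift_lift g) = g.
Proof.
rewrite -(im_push unshift_ext) => /morphimP[h _ Hh ->].
by rewrite /= [unshift_lift _]unshift_lift_push.
Qed.

Lemma unshift_liftM : {in perm_group X &, {morph unshift_lift : g h / g * h}}.
Proof.
move=> g h Gg Gh; have Hg := mem_unshift_lift g.
have Hh := mem_unshift_lift h.
rewrite -[RHS]unshift_lift_push ?groupM //; congr unshift_lift.
by rewrite (pushM ext_f) ?HG // !unshift_liftK.
Qed.

Definition lift_act (a : A) g := (a ^@ unshift_lift g)%R.

Let unshift_lift_norm g : unshift_lift g \in 'N(fiber_ker).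
Proof. by rewrite (subsetP fiber_ker_norm) // HG // mem_unshift_lift. Qed.

Lemma lift_is_action : is_action (perm_group X) lift_act.
Proof.
split=> [g a b e | a g h Gg Gh].
  exact: can_inj (actrK (unshift_lift g)) _ _ e.
by rewrite /lift_act unshift_liftM // actrM.
Qed.

Lemma lift_act_comp g x (a : A) : g \in perm_group X ->
  a \in fmod_comp x -> lift_act a g \in fmod_comp (g x).
Proof.
move=> Gg /fmod_compP aP; apply/fmod_compP=> y fy.
rewrite fmvalJ // conjgE !permM aP ?permKV // => e; apply: fy.
rewrite -(permKV (unshift_lift g) y) (pushE ext_f) ?HG ?mem_unshift_lift //.
by rewrite e unshift_liftK.
Qed.

Definition fiber_module : gradedModule X :=
  @GradedModule X A fmod_comp (Action lift_is_action) fmod_comp_closed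
    fmod_direct_sum (fun g _ => actAr (unshift_lift g)) lift_act_comp.

(** * Identification with the twisted extension *)

Variable s : X -> Y.
Hypothesis sK : cancel s f.
Hypothesis s_push : forall h x, h \in H -> h (s x) = s (push f h x).

Definition shift_twist (x y : X) : fiber_module :=
  fmodA (fiber_res (shift (s x)) y).

(** Equivariance combines [shiftJ] with the invariance of [s] under [H]. *)
Lemma shift_twisting : twisting shift_twist.
Proof.
split=> [x y | g x y Gg]; first exact/fmod_res_comp/ker_fiber_ker/shift_ker.
have Hl := mem_unshift_lift g; rewrite /= /lift_act -fmodJ //.
rewrite -fiber_resJ ?shift_ker ?HG // unshift_liftK // -shiftJ ?HG //.
by rewrite s_push // unshift_liftK.
Qed.

Definition twisted_point (u : twisted_ext shift_twisting) : Y :=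
  valA (val (u : scattering _)).2 (s (val (u : scattering _)).1).

Lemma f_twisted_point u : f (twisted_point u) = twisted_pr u.
Proof. by rewrite /twisted_point fiber_ker_f ?fmodP // sK. Qed.

(** On [Y], [sigma (s x)] is [shift (s x)] followed by [unshift_perm (s x)]. The first factor acts
    on the fiber of [y] as the twist; the second is the lift of [sigma x], which conjugates the
    module element and sends [s y] to [s (x ∗ y)]. *)
Lemma twisted_point_hom : cs_hom twisted_point.
Proof.
move=> u v; have fu := f_twisted_point u.
rewrite -[RHS]sigmaE -[sigma _](@f_sigma (s (twisted_pr u))) ?sK ?fu //.
clear fu; case: u v => [[x a] /= Aa] [[y b] /= Ab].
rewrite /twisted_point /twisted_pr /= /lift_act.
rewrite invgK fmvalJ // -sigmaE.
have hE : unshift_lift (sigma x) = unshift_perm (s x).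
  rewrite -sigma_unshift -[RHS]unshift_lift_push ?mem_sigma //.
  congr unshift_lift.
  rewrite -{1}(sK x); apply/esym; exact: (push_sigma unshift_ext).
rewrite -{2}(unshift_liftK (mem_sigma x)) -s_push ?mem_unshift_lift //.
rewrite conjgE !permM permK.
rewrite -/(valA (shift_twist x y)) -/(valA b).
have Bs : shift (s x) \in fiber_ker by apply/ker_fiber_ker/shift_ker.
rewrite fmodK ?fiber_res_mem // fiber_resE // fiber_ker_f ?fmodP //.
rewrite sK eqxx hE.
by rewrite -permM mulKVg.
Qed.

Lemma twisted_point_inj : injective twisted_point.
Proof.
move=> u v e; have := f_twisted_point v; rewrite -e f_twisted_point.
move: e; case: u v => [[x a] /= Aa] [[y b] /= Ab].
rewrite /twisted_point /twisted_pr /= => e exy; apply: val_inj => /=.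
case: y / exy Ab e => Ab e; congr (_, _); apply: val_inj; apply/permP=> z.
have [fz | nfz] := f z =P x; last first.
  by rewrite (fmod_compP _ _ Aa) ?(fmod_compP _ _ Ab).
by apply: fiber_ker_eq (fmodP a) (fmodP b) _ e; rewrite sK.
Qed.


Lemma twisted_point_surj y : exists u, twisted_point u = y.
Proof.
have [k Kk ky] : exists2 k, k \in K & k (s (f y)) = y.
  by apply: ker_push_fiber_trans; rewrite sK.
have Bk := ker_fiber_ker Kk.
exists (Sub (f y, fmodA (fiber_res k (f y))) (fmod_res_comp (f y) Bk)
  : scattering fiber_module).
by rewrite /twisted_point /= fmodK ?fiber_res_mem // fiber_resE // sK eqxx.
Qed.

Lemma twisted_ext_equiv : ext_equiv f (twisted_pr (hPhi := shift_twisting)).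
Proof.
have [i iK] := fin_all_exists twisted_point_surj.
have iKV : cancel twisted_point i.
  by apply: inj_can_sym; last exact: twisted_point_inj.
exists i => [|y]; last by rewrite /= -f_twisted_point iK.
split; last by exists twisted_point.
by move=> y z; apply: twisted_point_inj; rewrite twisted_point_hom !iK.
Qed.

End CoprimeExtension.

Theorem theorem2p11 (X Y : cycleSet) (f : Y -> X) (hf : coprime_extension f) :
  exists (A : gradedModule X) (Phi : X -> X -> A) (hPhi : twisting Phi),
    ext_equiv f (twisted_pr (hPhi := hPhi)).
Proof.
have [s [sK s_push]] := unshift_section hf.
exists (fiber_module hf), (shift_twist hf s), (shift_twisting s_push).
exact: twisted_ext_equiv.
Qed.
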